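(* Let $G=(V,E)$ be a loop-free multigraph with $n=|V|$. Consider the deterministic algorithm which, for $i=1,\dots,n$, having already fixed distinct vertices $v_1,\dots,v_{i-1}$, chooses $v_i\in V\setminus\{v_1,\dots,v_{i-1}\}$ maximizing $\mathbb{E}_{v_1,\dots,v_{i-1},v_i}$, and outputs the order $(v_1,\dots,v_n)$. The output order $\sigma$ satisfies $\sum_{v\in V}\overleftarrow{d}_\sigma(v)\overrightarrow{d}_\sigma(v)\ge\frac13\max_{\tau}\sum_{v\in V}\overleftarrow{d}_\tau(v)\overrightarrow{d}_\tau(v)$, the maximum being over all vertex orders $\tau$ of $G$.
   Context: A vertex order is a linear ordering $\sigma=(\sigma_1,\dots,\sigma_n)$ of $V$; for $v=\sigma_i$, the left-degree $\overleftarrow{d}_\sigma(v)$ is the number of edges (with multiplicity) joining $v$ to $\{\sigma_1,\dots,\sigma_{i-1}\}$ and the right-degree $\overrightarrow{d}_\sigma(v)$ is the number of edges joining $v$ to $\{\sigma_{i+1},\dots,\sigma_n\}$. For distinct vertices $v_1,\dots,v_i$, $\mathbb{E}_{v_1,\dots,v_i}$ denotes the average of $\sum_{v\in V}\overleftarrow{d}_\sigma(v)\overrightarrow{d}_\sigma(v)$ over all $(n-i)!$ vertex orders $\sigma$ with $\sigma_j=v_j$ for all $j\le i$. *)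

(* Defs.v *)
From mathcomp Require Import all_boot all_order all_algebra.

Set Implicit Arguments.
Unset Strict Implicit.
Unset Printing Implicit Defensive.

Import Order.TTheory GRing.Theory Num.Theory.

(* Distinct edges may have the same ends, so [ends] need not be injective;
   [#|ends e| = 2] excludes loops. *)
Record multigraph := Multigraph {
  vertex : finType;
  edge : finType;
  ends : edge -> {set vertex};
  card_ends : forall e, #|ends e| = 2
}.

Definition vertex_order (V : finType) := {t : #|V|.-tuple V | uniq t}.

Definition order_seq (V : finType) (s : vertex_order V) : seq V := val (val s).
Coercion order_seq : vertex_order >-> seq.

Section Degrees.

Variable G : multigraph.
Implicit Types (s : vertex_order (vertex G)) (v : vertex G).

Definition edges_joining v (A : {set vertex G}) : {set edge G} :=
  [set e | [exists u in A, ends e == [set u; v]]].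

Definition left_degree s v : nat :=
  #|edges_joining v [set u in take (index v s) s]|.

Definition right_degree s v : nat :=
  #|edges_joining v [set u in drop (index v s).+1 s]|.

Definition degree_product_sum s : nat :=
  \sum_(v : vertex G) left_degree s v * right_degree s v.

Local Open Scope ring_scope.

(* The average over the vertex orders starting with the entries of [p]. It is
   only meaningful for duplicate-free [p]; otherwise no order starts with [p]
   and the value is the junk 0 / 0 = 0. *)
Definition cond_expectation (p : seq (vertex G)) : rat :=
  (\sum_(s : vertex_order (vertex G) | prefix p s) (degree_product_sum s)%:R)
  / #|[set s : vertex_order (vertex G) | prefix p s]|%:R.

(* The states reachable by the algorithm, under every way of breaking ties
   between maximizers. *)
Inductive greedy_run : seq (vertex G) -> Prop :=
| greedy_start : greedy_run [::]
| greedy_step p v :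
    greedy_run p ->
    v \notin p ->
    (forall w, w \notin p ->
       cond_expectation (rcons p w) <= cond_expectation (rcons p v)) ->
    greedy_run (rcons p v).

Lemma greedy_run_uniq p : greedy_run p -> uniq p.
Proof. by elim=> // q v _ Uq vNq _; rewrite rcons_uniq vNq. Qed.

Lemma greedy_run_exists : exists s, greedy_run s.
Proof.
suff run k : (k <= #|vertex G|)%N -> exists2 p, greedy_run p & size p = k.
  have [p run_p /eqP size_p] := run _ (leqnn _).
  by exists (exist _ (Tuple size_p) (greedy_run_uniq run_p)).
elim: k => [|k IHk] lt_k; first by exists [::] => //; exact: greedy_start.
have [p run_p size_p] := IHk (ltnW lt_k).
have [v0 v0Np] : exists v, v \notin p.
  apply/existsP; apply: contraTT lt_k => /existsPn all_p; rewrite -leqNgt.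
  rewrite -size_p -(card_uniqP (greedy_run_uniq run_p)).
  by apply/subset_leq_card/subsetP => v _; have:= all_p v; rewrite negbK.
have [v vNp v_max] := @arg_maxP _ _ _ v0 (fun v => v \notin p)
  (fun v => cond_expectation (rcons p v)) v0Np.
exists (rcons p v); last by rewrite size_rcons size_p.
exact: greedy_step.
Qed.

End Degrees.

(* Main.v *)
(* For fixed [p], the average over the orders extending [p] is a weighted mean
   of the averages over the orders extending [rcons p v], so a greedy step never
   decreases it: the output is at least the average over all orders.  Writing
   the objective as a sum over triples [u, v, w] of products of multiplicities,
   each triple of distinct vertices appears in the order [u < v < w] in one
   sixth of the orders, while in a given order at most one of [u < v < w] and
   [w < v < u] holds; hence the average is at least [1/6 / (1/2) = 1/3] of any
   value. *)
Require Import Defs.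
From mathcomp Require Import all_boot all_order all_algebra all_fingroup.
From mathcomp Require Import zify.

Set Implicit Arguments.
Unset Strict Implicit.
Unset Printing Implicit Defensive.

Import Order.TTheory GRing.Theory Num.Theory.

(** * Vertex orders: extensions of a prefix, and relative positions of three vertices *)

Section Orders.

Variable V : finType.
Implicit Types (s t : vertex_order V) (p : seq V) (u v w : V).

Lemma order_uniq s : uniq s.
Proof. exact: valP s. Qed.

Lemma size_order s : size s = #|V|.
Proof. exact: size_tuple. Qed.

Lemma mem_order s v : v \in (s : seq V).
Proof.
have /subset_cardP eq_sV : #|(s : seq V)| = #|V|.
  by rewrite (card_uniqP (order_uniq s)) size_order.
by move/eq_sV: (subset_predT (mem (s : seq V))) => ->.
Qed.

Lemma order_seq_inj : injective (@order_seq V).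
Proof. by move=> s t eq_st; do 2!apply: val_inj. Qed.

Lemma index_order_neq s u v : u != v -> index u s != index v s.
Proof.
apply: contraNneq => eq_uv.
by rewrite -(nth_index u (mem_order s u)) eq_uv nth_index ?mem_order.
Qed.

Lemma prefix_orderE s t : prefix s t = (t == s).
Proof.
apply/idP/eqP => [|->]; last exact: prefix_refl.
case/prefixP => q def_t; apply: order_seq_inj.
have := congr1 size def_t; rewrite size_cat !size_order => sz.
have /size0nil q0 : size q = 0 by lia.
by rewrite def_t q0 cats0.
Qed.

(** Orders extending [p] are sorted by the entry that follows [p]. As [v] lies outside [p], no order
    stops at [p], so this entry exists, and it avoids [p] because orders are duplicate-free. *)
Lemma partition_prefix (R : nmodType) (F : vertex_order V -> R) p v :
  v \notin p ->
  (\sum_(s | prefix p (s : vertex_order V)) F s =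
   \sum_(w | w \notin p) \sum_(s | prefix (rcons p w) (s : vertex_order V)) F s)%R.
Proof.
(* Here [v] is only the default of [nth]; it is never returned as such, since position [size p] is
   always occupied. *)
move=> vNp; rewrite (partition_big (fun s => nth v s (size p))
  (fun w => w \notin p)) /=; last first.
  move=> s /prefixP[[|x q] def_s].
    by have := mem_order s v; rewrite def_s cats0 (negPf vNp).
  have := order_uniq s; rewrite def_s nth_cat ltnn subnn /= cat_uniq /=.
  by case/and3P=> _ /norP[].
apply: eq_bigr => w wNp; apply: eq_bigl => s.
apply/andP/prefixP => [[/prefixP[q def_s] /eqP nth_w] | [q def_s]].
  move: nth_w; rewrite def_s nth_cat ltnn subnn.
  case: q def_s => [|x q] def_s /= xw.
    by have := mem_order s v; rewrite def_s cats0 (negPf vNp).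
  by exists q; rewrite cat_rcons -xw.
rewrite def_s cat_rcons nth_cat ltnn subnn eqxx; split=> //.
by apply/prefixP; exists (w :: q).
Qed.

Fact map_order_uniq (g : {perm V}) s : uniq (map_tuple g (val s)).
Proof. by rewrite (map_inj_uniq perm_inj); exact: order_uniq. Qed.

Definition map_order (g : {perm V}) s : vertex_order V :=
  exist _ (map_tuple g (val s)) (map_order_uniq g s).

Lemma map_order_inj g : injective (map_order g).
Proof.
move=> s t /(congr1 (@order_seq V)) /= eq_st; apply: order_seq_inj.
exact: inj_map perm_inj _ _ eq_st.
Qed.

Definition appear_in_order s u v w : bool :=
  (index u s < index v s) && (index v s < index w s).

Definition count_orders u v w : nat :=
  \sum_(s : vertex_order V) appear_in_order s u v w.

(** Relabelling by [g] permutes the orders and keeps positions. *)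
Lemma count_orders_perm (g : {perm V}) u v w :
  count_orders (g u) (g v) (g w) = count_orders u v w.
Proof.
rewrite /count_orders (reindex_inj (@map_order_inj g)) /=.
apply: eq_bigr => s _; rewrite /appear_in_order.
by rewrite !(index_map (@perm_inj _ g)).
Qed.

Lemma appear_in_order_uniq s u v w :
  appear_in_order s u v w -> uniq [:: u; v; w].
Proof.
case/andP=> uv vw; rewrite /= !inE negb_or !andbT.
by apply/andP; split; [apply/andP; split|]; apply: contraL uv => /eqP E;
  subst; lia.
Qed.

(** The two arrangements exclude each other, and either one forces distinct vertices. This is the
    source of the factor 1/2. *)
Lemma appear_in_order_rev s u v w :
  appear_in_order s u v w + appear_in_order s w v u <= uniq [:: u; v; w].
Proof.
have := @appear_in_order_uniq s u v w; have := @appear_in_order_uniq s w v u.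
rewrite -(rev_uniq [:: u; v; w]) /rev /=.
rewrite /appear_in_order; lia.
Qed.

(** The six arrangements of three distinct vertices are equally frequent, by transpositions, and
    each order shows exactly one of them. *)
Lemma count_orders6 u v w :
  uniq [:: u; v; w] -> 6 * count_orders u v w = #|{: vertex_order V}|.
Proof.
move=> uvw; have swapl x y z : uniq [:: x; y; z] ->
    count_orders y x z = count_orders x y z.
  rewrite /= !inE negb_or !andbT => /andP[/andP[xy xz] yz].
  by rewrite -(count_orders_perm (tperm x y) x y z) tpermL tpermR tpermD.
have swapr x y z : uniq [:: x; y; z] ->
    count_orders x z y = count_orders x y z.
  rewrite /= !inE negb_or !andbT => /andP[/andP[xy xz] yz].
  by rewrite -(count_orders_perm (tperm y z) x y z) tpermL tpermR tpermD 1?eq_sym.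
have perm_uvw p : perm_eq p [:: u; v; w] -> uniq p by move/perm_uniq->.
transitivity (count_orders u v w + count_orders v u w + count_orders u w v
  + count_orders w u v + count_orders v w u + count_orders w v u).
  have uwv : uniq [:: u; w; v].
    by apply: perm_uvw; rewrite perm_cons (perm_catC [:: w] [:: v]).
  have vuw : uniq [:: v; u; w].
    by apply: perm_uvw; rewrite (perm_catCA [:: v] [:: u] [:: w]).
  have vwu : uniq [:: v; w; u].
    by apply: perm_uvw; rewrite (perm_catC [:: v; w] [:: u]).
  rewrite (swapl v w u) // (swapr v u w) // (swapl u w v) // (swapr u v w) //.
  rewrite (swapl u v w) //; lia.
(* For each order the six indicators add up to 1, because the three positions are distinct. *)
rewrite /count_orders -!big_split -[RHS]sum1_card /=; apply: eq_bigr => s _.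
have idx := @index_order_neq s.
move: uvw; rewrite /= !inE negb_or !andbT => /andP[/andP[/idx uv /idx uw] /idx vw].
rewrite /appear_in_order; lia.
Qed.

End Orders.

(** * The objective as a sum over triples of vertices *)

Section Greedy.

Variable G : multigraph.
Local Notation V := (vertex G).
Implicit Types (s t : vertex_order V) (p : seq V) (u v w : V).

Definition multiplicity u v : nat := #|[set e : edge G | ends e == [set u; v]]|.

(** The pair [[set u; v]] determines [u], so the edge classes for different [u] are disjoint. *)
Lemma card_edges_joining v (A : {set V}) :
  #|edges_joining v A| = \sum_(u in A) multiplicity u v.
Proof.
have set2_inj u w : [set u; v] = [set w; v] -> u = w.
  move=> /setP eq_uw; have := eq_uw u; have := eq_uw w.
  by rewrite !inE !eqxx /= (eq_sym w u); case: eqP => //= _ /eqP-> /esym/eqP->.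
have -> : edges_joining v A = \bigcup_(u in A) [set e | ends e == [set u; v]].
  apply/setP=> e; rewrite inE; apply/existsP/bigcupP => [[u /andP[Au ue]]|[u Au]].
    by exists u; rewrite ?inE.
  by rewrite inE => ue; exists u; rewrite Au.
rewrite -sum1_card; under [RHS]eq_bigr => u _ do rewrite /multiplicity -sum1_card.
rewrite (exchange_big_dep predT) //= big_mkcond /=; apply: eq_bigr => e _.
case: ifP => [/bigcupP[u Au] | eN].
  rewrite inE => /eqP eu; rewrite (bigD1 u) /= ?Au ?inE ?eu ?eqxx //.
  rewrite big1 // => w /andP[/andP[_]]; rewrite inE eu => /eqP/set2_inj->.
  by rewrite eqxx.
rewrite big1 // => u /andP[Au ue]; case/negP: (negbT eN).
by apply/bigcupP; exists u.
Qed.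

Lemma left_degreeE s v :
  left_degree s v = \sum_u multiplicity u v * (index u s < index v s).
Proof.
rewrite /left_degree card_edges_joining big_mkcond /=; apply: eq_bigr => u _.
rewrite inE in_take ?mem_order //; case: (_ < _); lia.
Qed.

Lemma mem_drop_uniq (T : eqType) (t : seq T) n x :
  uniq t -> x \in t -> (x \in drop n t) = (n <= index x t).
Proof.
move=> Ut tx; move: Ut (tx); rewrite -{1 2}(cat_take_drop n t) cat_uniq mem_cat.
case/and3P=> _ /hasPn dis _; rewrite leqNgt -in_take //.
by case: (boolP (x \in drop n t)) => [/dis->|_ /[!orbF]->].
Qed.

Lemma right_degreeE s v :
  right_degree s v = \sum_w multiplicity w v * (index v s < index w s).
Proof.
rewrite /right_degree card_edges_joining big_mkcond /=; apply: eq_bigr => w _.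
by rewrite inE mem_drop_uniq ?order_uniq ?mem_order //; case: (_ < _); lia.
Qed.

Lemma degree_product_sumE s :
  degree_product_sum s =
  \sum_v \sum_u \sum_w
    multiplicity u v * multiplicity w v * appear_in_order s u v w.
Proof.
apply: eq_bigr => v _; rewrite left_degreeE right_degreeE big_distrl /=.
apply: eq_bigr => u _; rewrite big_distrr /=; apply: eq_bigr => w _.
by rewrite /appear_in_order -mulnb mulnACA.
Qed.

(** The bound of the mean by a third, cleared of denominators. With [S] the weight of all triples of
    distinct vertices, twice any value is at most [S], while six times the total is [S] times the
    number of orders. *)
Lemma degree_product_sum_le_total s :
  #|{: vertex_order V}| * degree_product_sum s <=
  3 * \sum_(t : vertex_order V) degree_product_sum t.
Proof.
pose D u v w : nat := uniq [:: u; v; w].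
pose S := \sum_v \sum_u \sum_w multiplicity u v * multiplicity w v * D u v w.
have le2 : 2 * degree_product_sum s <= S.
  rewrite mul2n -addnn {2}degree_product_sumE degree_product_sumE /S -big_split /=.
  (* Swapping the roles of [u] and [w] in the second copy pairs each arrangement with its
     reverse. *)
  apply: leq_sum => v _; rewrite [X in _ + X]exchange_big -big_split /=.
  apply: leq_sum => u _; rewrite -big_split /=; apply: leq_sum => w _.
  by rewrite [X in _ + X * _]mulnC -mulnDr leq_mul2l appear_in_order_rev orbT.
have eq6 : 6 * \sum_(t : vertex_order V) degree_product_sum t
    = #|{: vertex_order V}| * S.
  under eq_bigr => t _ do rewrite degree_product_sumE.
  rewrite exchange_big /S !big_distrr /=; apply: eq_bigr => v _.
  rewrite exchange_big !big_distrr /=; apply: eq_bigr => u _.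
  rewrite exchange_big !big_distrr /=; apply: eq_bigr => w _.
  rewrite -big_distrr /= -/(count_orders u v w) /D.
  case: (boolP (uniq _)) => [/count_orders6 <-|uvwN]; first by lia.
  rewrite /count_orders big1 ?muln0 // => t _.
  by case: (boolP (appear_in_order t u v w)) => // /appear_in_order_uniq;
    rewrite (negPf uvwN).
have := leq_mul (leqnn #|{: vertex_order V}|) le2; lia.
Qed.

(** * Monotonicity of the conditional expectation along a greedy run *)

Local Open Scope ring_scope.

Lemma cond_expectation_ge0 p : 0 <= cond_expectation p.
Proof. by rewrite divr_ge0 ?ler0n // sumr_ge0 // => s _; apply: ler0n. Qed.

(** This also covers prefixes that no order extends: both sides are then 0. *)
Lemma cond_expectationMcard p :
  cond_expectation p * #|[set s : vertex_order V | prefix p s]|%:R =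
  \sum_(s : vertex_order V | prefix p s) (degree_product_sum s)%:R.
Proof.
have [c0|cN0] := eqVneq #|[set s : vertex_order V | prefix p s]| 0%N; last first.
  by rewrite divfK // pnatr_eq0.
rewrite c0 mulr0 big1 // => s ps.
by have := in_set0 s; rewrite -(cards0_eq c0) inE ps.
Qed.

Lemma cond_expectation_step p v :
  v \notin p ->
  (forall w, w \notin p ->
     cond_expectation (rcons p w) <= cond_expectation (rcons p v)) ->
  cond_expectation p <= cond_expectation (rcons p v).
Proof.
move=> vNp v_max.
have [c0|cN0] := eqVneq #|[set s : vertex_order V | prefix p s]| 0%N.
  (* With no extension of [p], its average is the junk value 0, below any average. *)
  by rewrite {1}/cond_expectation c0 invr0 mulr0 cond_expectation_ge0.
rewrite /(cond_expectation p) ler_pdivrMr ?ltr0n ?lt0n //.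
(* Numerator and count are both split by the next vertex [w], so the averages compare term by
   term. *)
rewrite -sum1dep_card natr_sum !(partition_prefix _ vNp) mulr_sumr.
apply: ler_sum => w wNp; rewrite -cond_expectationMcard -natr_sum sum1dep_card.
by rewrite ler_wpM2r ?ler0n ?v_max.
Qed.

Lemma cond_expectation_greedy p :
  greedy_run p -> cond_expectation (Nil V) <= cond_expectation p.
Proof.
by elim=> // q v _ IHq vNq v_max; apply: le_trans IHq (cond_expectation_step _ _).
Qed.

Lemma cond_expectation_order s :
  cond_expectation s = (degree_product_sum s)%:R.
Proof.
rewrite /cond_expectation -sum1dep_card.
by rewrite !(big_pred1 s (prefix_orderE s)) divr1.
Qed.

Lemma degree_product_sum_le_mean s :
  3%:R^-1 * (degree_product_sum s)%:R <= cond_expectation (Nil V).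
Proof.
have N_gt0 : (0 < #|{: vertex_order V}|)%N by apply/card_gt0P; exists s.
rewrite /cond_expectation -sum1dep_card.
rewrite !(eq_bigl predT _ (fun t : vertex_order V => prefix0s t)) /=.
rewrite sum1_card -natr_sum ler_pdivlMr ?ltr0n // -mulrA ler_pdivrMl ?ltr0n //.
by rewrite -!natrM ler_nat mulnC degree_product_sum_le_total.
Qed.

End Greedy.

Local Open Scope ring_scope.

Theorem theorem18 (G : multigraph) (sigma : vertex_order (vertex G)) :
  greedy_run sigma ->
  (degree_product_sum sigma)%:R >=
    3%:R^-1 * (\max_(tau : vertex_order (vertex G)) degree_product_sum tau)%:R
    :> rat.
Proof.
move=> run_sigma; rewrite -cond_expectation_order.
apply: le_trans (cond_expectation_greedy run_sigma).
(* The maximum is attained at some [tau]; [sigma] witnesses that orders exist. *)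
have [|tau ->] := @bigop.eq_bigmax _ (@degree_product_sum G).
  by apply/card_gt0P; exists sigma.
exact: degree_product_sum_le_mean.
Qed.
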